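(* Let $R$ be any ring with identity. The following hold. (1) If $A$ is an absolutely clean chain complex of $R$-modules, then $\mathrm{Ext}^n_{\mathrm{Ch}(R)}(X,A)=0$ for all $n>0$ and all chain complexes $X$ of type $FP_\infty$. (2) The class of absolutely clean chain complexes is closed under pure subcomplexes and pure quotients (quotients by pure subcomplexes). In fact, it is closed under clean subcomplexes and clean quotients (quotients by clean subcomplexes). (3) The class of absolutely clean chain complexes is coresolving; that is, it contains the injective chain complexes and is closed under extensions and cokernels of monomorphisms (i.e. if $0 \to A' \to A \to A'' \to 0$ is exact with $A', A$ absolutely clean, then $A''$ is absolutely clean). (4) The class of absolutely clean chain complexes is closed under direct products, direct sums, retracts, direct limits, and transfinite extensions.
   Context: $R$-modules are left $R$-modules; $\mathrm{Ch}(R)$ is the category of ($\mathbb{Z}$-graded, unbounded) chain complexes of $R$-modules. A chain complex is finitely generated if it is bounded and finitely generated in each degree. Injective (projective) complexes are the injective (projective) objects of $\mathrm{Ch}(R)$. A chain complex $X$ is of type $FP_\infty$ if it has a projective resolution $\cdots \to P_2 \to P_1 \to P_0 \to X \to 0$ in $\mathrm{Ch}(R)$ with each $P_i$ a finitely generated projective object of $\mathrm{Ch}(R)$. A chain complex $A$ is absolutely clean if $\mathrm{Ext}^1_{\mathrm{Ch}(R)}(X,A)=0$ for all chain complexes $X$ of type $FP_\infty$. A short exact sequence of chain complexes is pure exact if it remains exact after applying $\mathrm{Hom}_{\mathrm{Ch}(R)}(F,-)$ for every finitely presented complex $F$; it is clean exact if it remains exact after applying $\mathrm{Hom}_{\mathrm{Ch}(R)}(F,-)$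 for every complex $F$ of type $FP_\infty$. A subcomplex $P \subseteq X$ is pure (resp. clean) if $0 \to P \to X \to X/P \to 0$ is pure exact (resp. clean exact). Given a collection $\mathcal{D}$ of chain complexes, $X$ is a transfinite extension of objects in $\mathcal{D}$ if there is an ordinal $\lambda$ and a colimit-preserving functor $X_{(-)} : \lambda \to \mathrm{Ch}(R)$ with $X_0 \in \mathcal{D}$ such that each map $X_i \to X_{i+1}$ is a monomorphism whose cokernel is in $\mathcal{D}$, and such that $\mathrm{colim}_{i<\lambda} X_i \cong X$. *)

(* Defs.v *)
From mathcomp Require Import all_boot all_order all_algebra.

Set Implicit Arguments.
Unset Strict Implicit.
Unset Printing Implicit Defensive.

Import Order.TTheory GRing.Theory.
Local Open Scope ring_scope.

(** Unbounded chain complexes of left R-modules: the differential lowers the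
    degree by one.  [R] is a [pzRingType], so that the zero ring is allowed. *)

Record chain_complex (R : pzRingType) := ChainComplex {
  ch_mod :> int -> lmodType R;
  ch_d : forall n : int, {linear ch_mod n -> ch_mod (n - 1)};
  ch_dd : forall (n : int) (x : ch_mod n), ch_d (n - 1) (ch_d n x) = 0 }.

Arguments ch_d {R} c n.

Record chain_map (R : pzRingType) (X Y : chain_complex R) := ChainMap {
  ch_fun :> forall n : int, {linear X n -> Y n};
  ch_comm : forall (n : int) (x : X n),
    ch_fun (n - 1) (ch_d X n x) = ch_d Y n (ch_fun n x) }.

(** Equations between chain maps are stated pointwise, so that they do not
    depend on function extensionality or proof irrelevance. *)

Definition ch_eq (R : pzRingType) (X Y : chain_complex R)
    (f g : chain_map X Y) : Prop :=
  forall (n : int) (x : X n), f n x = g n x.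

Definition ch_is0 (R : pzRingType) (X Y : chain_complex R)
    (f : chain_map X Y) : Prop :=
  forall (n : int) (x : X n), f n x = 0.

Definition is_comp (R : pzRingType) (X Y Z : chain_complex R)
    (g : chain_map Y Z) (f : chain_map X Y) (h : chain_map X Z) : Prop :=
  forall (n : int) (x : X n), g n (f n x) = h n x.

Definition comp0 (R : pzRingType) (X Y Z : chain_complex R)
    (g : chain_map Y Z) (f : chain_map X Y) : Prop :=
  forall (n : int) (x : X n), g n (f n x) = 0.

(** Monomorphisms, epimorphisms and exactness in Ch(R) are degreewise. *)

Definition ch_mono (R : pzRingType) (X Y : chain_complex R)
    (f : chain_map X Y) : Prop :=
  forall n : int, injective (f n).

Definition ch_epi (R : pzRingType) (X Y : chain_complex R)
    (f : chain_map X Y) : Prop :=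
  forall (n : int) (y : Y n), exists x : X n, f n x = y.

Definition ch_exact (R : pzRingType) (X Y Z : chain_complex R)
    (f : chain_map X Y) (g : chain_map Y Z) : Prop :=
  forall (n : int) (y : Y n), g n y = 0 <-> exists x : X n, f n x = y.

Definition short_exact (R : pzRingType) (X Y Z : chain_complex R)
    (f : chain_map X Y) (g : chain_map Y Z) : Prop :=
  [/\ ch_mono f, ch_exact f g & ch_epi g].

Definition projective_complex (R : pzRingType) (P : chain_complex R) : Prop :=
  forall (X Y : chain_complex R) (p : chain_map X Y) (f : chain_map P Y),
    ch_epi p -> exists g : chain_map P X, is_comp p g f.

Definition injective_complex (R : pzRingType) (J : chain_complex R) : Prop :=
  forall (X Y : chain_complex R) (i : chain_map X Y) (f : chain_map X J),
    ch_mono i -> exists g : chain_map Y J, is_comp g i f.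

Definition fg_module (R : pzRingType) (M : lmodType R) : Prop :=
  exists (k : nat) (s : 'I_k -> M),
    forall x : M, exists c : 'I_k -> R, x = \sum_(i < k) c i *: s i.

Definition bounded_complex (R : pzRingType) (X : chain_complex R) : Prop :=
  exists a b : int,
    forall n : int, (n < a) || (b < n) -> forall x : X n, x = 0.

Definition fg_complex (R : pzRingType) (X : chain_complex R) : Prop :=
  bounded_complex X /\ forall n : int, fg_module (X n).

Definition fp_complex (R : pzRingType) (X : chain_complex R) : Prop :=
  exists (P1 P0 : chain_complex R)
         (d : chain_map P1 P0) (e : chain_map P0 X),
    [/\ projective_complex P1 /\ fg_complex P1,
        projective_complex P0 /\ fg_complex P0,
        ch_exact d e
      & ch_epi e].

Record proj_resolution (R : pzRingType) (X : chain_complex R) :=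
  ProjResolution {
    pr_ob :> nat -> chain_complex R;
    pr_d : forall k : nat, chain_map (pr_ob k.+1) (pr_ob k);
    pr_aug : chain_map (pr_ob 0) X;
    pr_proj : forall k : nat, projective_complex (pr_ob k);
    pr_aug_epi : ch_epi pr_aug;
    pr_exact0 : ch_exact (pr_d 0) pr_aug;
    pr_exactS : forall k : nat, ch_exact (pr_d k.+1) (pr_d k) }.

Arguments pr_d {R X} p k.

Definition type_FPinf (R : pzRingType) (X : chain_complex R) : Prop :=
  exists P : proj_resolution X, forall k : nat, fg_complex (P k).

(** Cocycles and coboundaries of the cochain complex
    Hom(P_0, A) -> Hom(P_1, A) -> Hom(P_2, A) -> ... *)

Definition ext_cocycle (R : pzRingType) (X A : chain_complex R)
    (P : proj_resolution X) (k : nat) (f : chain_map (P k) A) : Prop :=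
  comp0 f (pr_d P k).

Definition ext_coboundary (R : pzRingType) (X A : chain_complex R)
    (P : proj_resolution X) (k : nat) : chain_map (P k) A -> Prop :=
  match k return chain_map (P k) A -> Prop with
  | 0 => fun f => ch_is0 f
  | j.+1 => fun f => exists g : chain_map (P j) A, is_comp g (pr_d P j) f
  end.

(** [Ext_vanishes k X A] is Ext^k(X, A) = 0, i.e. H^k(Hom(P, A)) = 0; this
    group does not depend on the projective resolution P of X, up to
    isomorphism. *)

Definition Ext_vanishes (R : pzRingType) (k : nat)
    (X A : chain_complex R) : Prop :=
  forall (P : proj_resolution X) (f : chain_map (P k) A),
    ext_cocycle f -> ext_coboundary f.

Definition absolutely_clean (R : pzRingType) (A : chain_complex R) : Prop :=
  forall X : chain_complex R, type_FPinf X -> Ext_vanishes 1 X A.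

(** Exactness of 0 -> Hom(F, X) -> Hom(F, Y) -> Hom(F, Z) -> 0. *)

Definition hom_short_exact (R : pzRingType) (F X Y Z : chain_complex R)
    (i : chain_map X Y) (p : chain_map Y Z) : Prop :=
  [/\ forall f g : chain_map F X,
        (forall n x, i n (f n x) = i n (g n x)) -> ch_eq f g,
      forall h : chain_map F Y,
        comp0 p h <-> exists f : chain_map F X, is_comp i f h
    & forall h : chain_map F Z,
        exists g : chain_map F Y, is_comp p g h].

Definition pure_exact (R : pzRingType) (X Y Z : chain_complex R)
    (i : chain_map X Y) (p : chain_map Y Z) : Prop :=
  short_exact i p /\
  forall F : chain_complex R, fp_complex F -> hom_short_exact F i p.

Definition clean_exact (R : pzRingType) (X Y Z : chain_complex R)
    (i : chain_map X Y) (p : chain_map Y Z) : Prop :=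
  short_exact i p /\
  forall F : chain_complex R, type_FPinf F -> hom_short_exact F i p.

Definition is_product (R : pzRingType) (I : Type) (X : I -> chain_complex R)
    (P : chain_complex R) (pi : forall i : I, chain_map P (X i)) : Prop :=
  forall (Y : chain_complex R) (f : forall i : I, chain_map Y (X i)),
    (exists g : chain_map Y P, forall i : I, is_comp (pi i) g (f i)) /\
    (forall g h : chain_map Y P,
       (forall i : I, is_comp (pi i) g (f i)) ->
       (forall i : I, is_comp (pi i) h (f i)) -> ch_eq g h).

Definition is_coproduct (R : pzRingType) (I : Type) (X : I -> chain_complex R)
    (S : chain_complex R) (inj : forall i : I, chain_map (X i) S) : Prop :=
  forall (Y : chain_complex R) (f : forall i : I, chain_map (X i) Y),
    (exists g : chain_map S Y, forall i : I, is_comp g (inj i) (f i)) /\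
    (forall g h : chain_map S Y,
       (forall i : I, is_comp g (inj i) (f i)) ->
       (forall i : I, is_comp h (inj i) (f i)) -> ch_eq g h).

Definition is_retract (R : pzRingType) (X Y : chain_complex R) : Prop :=
  exists (s : chain_map X Y) (r : chain_map Y X),
    forall (n : int) (x : X n), r n (s n x) = x.

(** Functors from a preordered set, seen as a category, to Ch(R). *)

Record diagram (R : pzRingType) (disp : Order.disp_t)
    (I : preorderType disp) := Diagram {
  dg_ob :> I -> chain_complex R;
  dg_map : forall i j : I, (i <= j)%O -> chain_map (dg_ob i) (dg_ob j);
  dg_id : forall (i : I) (ii : (i <= i)%O) (n : int) (x : dg_ob i n),
    dg_map ii n x = x;
  dg_comp : forall (i j k : I)
      (ij : (i <= j)%O) (jk : (j <= k)%O) (ik : (i <= k)%O),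
    is_comp (dg_map jk) (dg_map ij) (dg_map ik) }.

(** Cocones under, and colimits of, the restriction of the diagram [D] to the
    full subcategory of the indices satisfying [S]. *)

Definition is_cocone (R : pzRingType) (disp : Order.disp_t)
    (I : preorderType disp) (D : diagram R I) (S : pred I)
    (C : chain_complex R) (u : forall i : I, S i -> chain_map (D i) C) : Prop :=
  forall (i j : I) (Si : S i) (Sj : S j) (ij : (i <= j)%O),
    is_comp (u j Sj) (dg_map D ij) (u i Si).

Definition is_colimit (R : pzRingType) (disp : Order.disp_t)
    (I : preorderType disp) (D : diagram R I) (S : pred I)
    (C : chain_complex R) (u : forall i : I, S i -> chain_map (D i) C) : Prop :=
  is_cocone u /\
  forall (Y : chain_complex R) (f : forall i : I, S i -> chain_map (D i) Y),
    is_cocone f ->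
    (exists g : chain_map C Y,
       forall (i : I) (Si : S i), is_comp g (u i Si) (f i Si)) /\
    (forall g h : chain_map C Y,
       (forall (i : I) (Si : S i), is_comp g (u i Si) (f i Si)) ->
       (forall (i : I) (Si : S i), is_comp h (u i Si) (f i Si)) -> ch_eq g h).

Definition is_colim_of (R : pzRingType) (disp : Order.disp_t)
    (I : preorderType disp) (D : diagram R I) (C : chain_complex R) : Prop :=
  exists u : forall i : I, predT i -> chain_map (D i) C, is_colimit u.

Definition directed (disp : Order.disp_t) (I : preorderType disp) : Prop :=
  inhabited I /\
  forall i j : I, exists k : I, (i <= k)%O /\ (j <= k)%O.

Section Transfinite.

Variables (R : pzRingType) (disp : Order.disp_t) (I : orderType disp).

Definition is_bottom (i : I) : Prop := forall j : I, (i <= j)%O.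

Definition is_succ (i j : I) : Prop :=
  (i < j)%O /\ forall k : I, (i < k)%O -> (j <= k)%O.

Definition is_limit (m : I) : Prop :=
  ~ is_bottom m /\ forall i : I, ~ is_succ i m.

(** Preservation of colimits by a functor on an ordinal means, as usual, that
    X_m is the colimit of the X_i, i < m, for every limit ordinal m. *)

Definition continuous_diagram (D : diagram R I) : Prop :=
  forall m : I, is_limit m ->
    is_colimit (S := fun i : I => (i < m)%O)
      (fun (i : I) (im : (i < m)%O) => dg_map D (ltW im)).

End Transfinite.

(** The ordinal lambda is an arbitrary (nonempty) well-ordered set. *)

Definition transfinite_extension (R : pzRingType)
    (C : chain_complex R -> Prop) (X : chain_complex R) : Prop :=
  exists (disp : Order.disp_t) (I : orderType disp) (D : diagram R I),
    [/\ well_founded (fun i j : I => (i < j)%O : Prop),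
        continuous_diagram D,
        exists i0 : I, is_bottom i0 /\ C (D i0),
        forall (i j : I) (ij : (i <= j)%O), is_succ i j ->
          exists (Q : chain_complex R) (q : chain_map (D j) Q),
            short_exact (dg_map D ij) q /\ C Q
      & is_colim_of D X].

(** Closure properties of a class of complexes. *)

Definition closed_under_pure (R : pzRingType)
    (C : chain_complex R -> Prop) : Prop :=
  forall (P X Q : chain_complex R) (i : chain_map P X) (p : chain_map X Q),
    pure_exact i p -> C X -> C P /\ C Q.

Definition closed_under_clean (R : pzRingType)
    (C : chain_complex R -> Prop) : Prop :=
  forall (P X Q : chain_complex R) (i : chain_map P X) (p : chain_map X Q),
    clean_exact i p -> C X -> C P /\ C Q.

Definition coresolving (R : pzRingType)
    (C : chain_complex R -> Prop) : Prop :=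
  [/\ forall J : chain_complex R, injective_complex J -> C J,
      forall (A' A A'' : chain_complex R)
          (i : chain_map A' A) (p : chain_map A A''),
        short_exact i p -> C A' -> C A'' -> C A
    & forall (A' A A'' : chain_complex R)
          (i : chain_map A' A) (p : chain_map A A''),
        short_exact i p -> C A' -> C A -> C A''].

Definition closed_under_products (R : pzRingType)
    (C : chain_complex R -> Prop) : Prop :=
  forall (I : Type) (X : I -> chain_complex R) (P : chain_complex R)
      (pi : forall i : I, chain_map P (X i)),
    is_product pi -> (forall i : I, C (X i)) -> C P.

Definition closed_under_direct_sums (R : pzRingType)
    (C : chain_complex R -> Prop) : Prop :=
  forall (I : Type) (X : I -> chain_complex R) (S : chain_complex R)
      (inj : forall i : I, chain_map (X i) S),
    is_coproduct inj -> (forall i : I, C (X i)) -> C S.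

Definition closed_under_retracts (R : pzRingType)
    (C : chain_complex R -> Prop) : Prop :=
  forall X Y : chain_complex R, is_retract X Y -> C Y -> C X.

Definition closed_under_direct_limits (R : pzRingType)
    (C : chain_complex R -> Prop) : Prop :=
  forall (disp : Order.disp_t) (I : preorderType disp) (D : diagram R I)
      (X : chain_complex R),
    directed I -> is_colim_of D X -> (forall i : I, C (D i)) -> C X.

Definition closed_under_transfinite_extensions (R : pzRingType)
    (C : chain_complex R -> Prop) : Prop :=
  forall X : chain_complex R, transfinite_extension C X -> C X.

(* Main.v *)
(** Comparing two resolutions of [X] up to homotopy shows that Ext^n(X, A),
    n > 0, can be tested on a resolution [P] of [X] by finitely generated
    projectives: [A] is absolutely clean iff every cocycle [P 1 -> A] extends
    along [P 1 -> P 0].  A syzygy of a complex of type FP_oo is again of type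
    FP_oo, so vanishing of Ext^1 gives vanishing of all Ext^n, and a cocycle
    [P 1 -> A''] is a map from a syzygy, so that it lifts along a clean
    epimorphism.  A complex of type FP_oo is finitely presented, so pure implies
    clean, and an extension with absolutely clean kernel is clean.  Since [P 1]
    and [P 2] are finitely generated projective, a cocycle [P 1 -> colim D_i]
    over a directed system is already a cocycle [P 1 -> D_k] for some [k], and
    a cocycle into a direct sum has finitely many nonzero components;
    transfinite extensions follow by well-founded induction from extensions and
    directed colimits. *)

From HB Require Import structures.
From mathcomp Require Import boolp.
From mathcomp Require Import generic_quotient ring_quotient.
Require Import Defs.
From mathcomp Require Import all_boot all_order all_algebra.

Set Implicit Arguments.
Unset Strict Implicit.
Unset Printing Implicit Defensive.

Import Order.TTheory GRing.Theory Num.Theory.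
Local Open Scope ring_scope.

(** * Submodules and quotient modules defined by a predicate *)

Definition submodule_prop (R : pzRingType) (V : lmodType R) (P : V -> Prop) :=
  P 0 /\ forall (a : R) (x y : V), P x -> P y -> P (a *: x + y).

Section Submodule.
Variables (R : pzRingType) (V : lmodType R) (P : V -> Prop).
Hypothesis HP : submodule_prop P.

Definition submod_pred : {pred V} := fun x => `[< P x >].

Fact submod_pred_closed : submod_closed submod_pred.
Proof.
case: HP => P0 PZD; split=> [|a x y]; rewrite !unfold_in; first exact/asboolP.
by move=> /asboolP Px /asboolP Py; apply/asboolP/PZD.
Qed.

HB.instance Definition _ :=
  GRing.isSubmodClosed.Build R V submod_pred submod_pred_closed.

Record submod_sort := Submod { submod_val : V; _ : submod_val \in submod_pred }.
HB.instance Definition _ := [isSub for submod_val].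
HB.instance Definition _ := [Choice of submod_sort by <:].
HB.instance Definition _ := [SubChoice_isSubLmodule of submod_sort by <:].

Definition submod : lmodType R := submod_sort.

Definition submod_incl : {linear submod -> V} := (val : submod_sort -> V).

Lemma submod_incl_inj : injective submod_incl.
Proof. exact: val_inj. Qed.

Lemma submod_inclP (x : V) : P x <-> exists y : submod, submod_incl y = x.
Proof.
split=> [/asboolP Px|[[y /asboolP Py] <-//]].
by exists (Submod (Px : x \in submod_pred)).
Qed.

Local Open Scope quotient_scope.

Definition quotmod_sort := Quotient.quot submod_pred.
HB.instance Definition _ := GRing.Zmodule.on quotmod_sort.

Let quot_pi (x : V) : quotmod_sort := \pi_(Quotient.quot submod_pred) x.

Let quot_pi_additive : zmod_morphism quot_pi.
Proof. exact: raddfB. Qed.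
HB.instance Definition _ :=
  GRing.isZmodMorphism.Build V quotmod_sort quot_pi quot_pi_additive.

Let quot_pi_repr (x : quotmod_sort) : quot_pi (repr x) = x.
Proof. exact: reprK. Qed.

Let quot_pi_eq0 (x : V) : (quot_pi x == 0) = (x \in submod_pred).
Proof. by rewrite -(raddf0 quot_pi) -[LHS]Quotient.idealrBE subr0. Qed.

(** [quotmod_sort] comes with its additive group only; the action is taken on the chosen
    representative, and [quot_pi_scale] makes it independent of that choice. *)
Definition quotmod_scale (a : R) (x : quotmod_sort) : quotmod_sort :=
  quot_pi (a *: repr x).

Let quot_pi_scale (a : R) (x : V) :
  quotmod_scale a (quot_pi x) = quot_pi (a *: x).
Proof.
apply/eqP; rewrite -subr_eq0 -raddfB -scalerBr quot_pi_eq0 rpredZ //.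
by rewrite -quot_pi_eq0 raddfB /= quot_pi_repr subrr.
Qed.

Fact quotmod_scalerA (a b : R) (x : quotmod_sort) :
  quotmod_scale a (quotmod_scale b x) = quotmod_scale (a * b) x.
Proof. by rewrite -[x]quot_pi_repr !quot_pi_scale scalerA. Qed.

Fact quotmod_scale1r : left_id 1 quotmod_scale.
Proof. by move=> x; rewrite -[x]quot_pi_repr quot_pi_scale scale1r. Qed.

Fact quotmod_scalerDr : right_distributive quotmod_scale +%R.
Proof.
move=> a x y; rewrite -[x]quot_pi_repr -[y]quot_pi_repr.
by rewrite -raddfD !quot_pi_scale scalerDr raddfD.
Qed.

Fact quotmod_scalerDl (x : quotmod_sort) :
  {morph quotmod_scale^~ x : a b / a + b}.
Proof. by move=> a b; rewrite /quotmod_scale scalerDl raddfD. Qed.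

HB.instance Definition _ := GRing.Zmodule_isLmodule.Build R quotmod_sort
  quotmod_scalerA quotmod_scale1r quotmod_scalerDr quotmod_scalerDl.

Definition quotmod : lmodType R := quotmod_sort.

Let quot_pi_scalable : scalable quot_pi.
Proof. by move=> a x; rewrite -quot_pi_scale. Qed.
HB.instance Definition _ :=
  GRing.isScalable.Build R V quotmod_sort *:%R quot_pi quot_pi_scalable.

Definition quotmod_proj : {linear V -> quotmod} := quot_pi.

Lemma quotmod_proj_surj (y : quotmod) : exists x, quotmod_proj x = y.
Proof. by exists (repr y); exact: quot_pi_repr. Qed.

Lemma quotmod_proj_eq0 (x : V) : quotmod_proj x = 0 <-> P x.
Proof.
split=> [/eqP|Px]; first by rewrite [_ == _]quot_pi_eq0 => /asboolP.
by apply/eqP; rewrite [_ == _]quot_pi_eq0; apply/asboolP.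
Qed.

End Submodule.

(** * Products of modules, as dependent functions *)

Section ProductModule.
Variables (R : pzRingType) (I : Type) (V : I -> lmodType R).

Definition prodmod_sort := forall i : I, V i.
HB.instance Definition _ := Choice.on prodmod_sort.

Let add (x y : prodmod_sort) : prodmod_sort := fun i => x i + y i.
Let opp (x : prodmod_sort) : prodmod_sort := fun i => - x i.
Let scale (a : R) (x : prodmod_sort) : prodmod_sort := fun i => a *: x i.

Fact prodmod_addA : associative add.
Proof. by move=> x y z; apply: functional_extensionality_dep => i; exact: addrA. Qed.
Fact prodmod_addC : commutative add.
Proof. by move=> x y; apply: functional_extensionality_dep => i; exact: addrC. Qed.
Fact prodmod_add0 : left_id (fun i => 0) add.
Proof. by move=> x; apply: functional_extensionality_dep => i; exact: add0r. Qed.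
Fact prodmod_addN : left_inverse (fun i => 0) opp add.
Proof. by move=> x; apply: functional_extensionality_dep => i; exact: addNr. Qed.

HB.instance Definition _ := GRing.isZmodule.Build prodmod_sort
  prodmod_addA prodmod_addC prodmod_add0 prodmod_addN.

Fact prodmod_scaleA (a b : R) (x : prodmod_sort) :
  scale a (scale b x) = scale (a * b) x.
Proof. by apply: functional_extensionality_dep => i; exact: scalerA. Qed.
Fact prodmod_scale1 : left_id 1 scale.
Proof. by move=> x; apply: functional_extensionality_dep => i; exact: scale1r. Qed.
Fact prodmod_scaleDr : right_distributive scale +%R.
Proof. by move=> a x y; apply: functional_extensionality_dep => i; exact: scalerDr. Qed.
Fact prodmod_scaleDl (x : prodmod_sort) : {morph scale^~ x : a b / a + b}.
Proof. by move=> a b; apply: functional_extensionality_dep => i; exact: scalerDl. Qed.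

HB.instance Definition _ := GRing.Zmodule_isLmodule.Build R prodmod_sort
  prodmod_scaleA prodmod_scale1 prodmod_scaleDr prodmod_scaleDl.

Definition prodmod : lmodType R := prodmod_sort.

End ProductModule.

(** * Factoring linear maps through surjections and injections *)

Section LinearFactor.
Variables (R : pzRingType) (U V W : lmodType R).

(** The factor is returned in a sigma type, with preimages picked by [xchoose], so that one such map
    per degree can be assembled into a chain map. *)
Lemma linear_factor_surj (p : {linear U -> V}) (f : {linear U -> W}) :
  (forall y, exists x, p x = y) -> (forall x, p x = 0 -> f x = 0) ->
  {g : {linear V -> W} | forall x, g (p x) = f x}.
Proof.
move=> p_surj ker_le.
have p_surjb y : exists x, p x == y by have [x <-] := p_surj y; exists x.
pose g y := f (xchoose (p_surjb y)).
have gp x : g (p x) = f x.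
  apply/eqP; rewrite -subr_eq0 -raddfB; apply/eqP/ker_le.
  by rewrite raddfB /= (eqP (xchooseP (p_surjb (p x)))) subrr.
have g_lin : linear g.
  move=> a y z; have [x <-] := p_surj y; have [x' <-] := p_surj z.
  by rewrite -linearP !gp linearP.
pose gL := GRing.isLinear.Build R V W *:%R g g_lin.
by exists (HB.pack_for {linear V -> W} g gL).
Qed.

Lemma linear_factor_inj (i : {linear U -> V}) (f : {linear W -> V}) :
  injective i -> (forall z, exists x, i x = f z) ->
  {g : {linear W -> U} | forall z, i (g z) = f z}.
Proof.
move=> i_inj im_le.
have im_leb z : exists x, i x == f z by have [x <-] := im_le z; exists x.
pose g z := xchoose (im_leb z).
have ig z : i (g z) = f z := eqP (xchooseP (im_leb z)).
have g_lin : linear g by move=> a y z; apply: i_inj; rewrite linearP !ig linearP.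
pose gL := GRing.isLinear.Build R W U *:%R g g_lin.
by exists (HB.pack_for {linear W -> U} g gL).
Qed.

End LinearFactor.

(** * Chain maps, subcomplexes, quotient complexes, and lifting from projectives *)

Section ChainMaps.
Variable R : pzRingType.
Implicit Types X Y Z : chain_complex R.

Program Definition ch_id X : chain_map X X :=
  ChainMap (ch_fun := fun n => idfun : {linear X n -> X n}) _.

Program Definition ch_comp X Y Z (g : chain_map Y Z) (f : chain_map X Y) :
    chain_map X Z :=
  ChainMap (ch_fun := fun n => (g n \o f n : {linear X n -> Z n})) _.
Next Obligation. by rewrite !ch_comm. Qed.

Program Definition ch_zero X Y : chain_map X Y :=
  ChainMap (ch_fun := fun n => (\0 : {linear X n -> Y n})) _.
Next Obligation. by rewrite linear0. Qed.

Program Definition ch_add X Y (f g : chain_map X Y) : chain_map X Y :=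
  ChainMap (ch_fun := fun n => (f n \+ g n : {linear X n -> Y n})) _.
Next Obligation. by rewrite linearD !ch_comm. Qed.

Program Definition ch_sub X Y (f g : chain_map X Y) : chain_map X Y :=
  ChainMap (ch_fun := fun n => (f n \- g n : {linear X n -> Y n})) _.
Next Obligation. by rewrite linearB !ch_comm. Qed.

Lemma ch_factor_epi X Y Z (p : chain_map X Y) (f : chain_map X Z) :
  ch_epi p -> (forall n x, p n x = 0 -> f n x = 0) ->
  exists g : chain_map Y Z, is_comp g p f.
Proof.
move=> p_epi ker_le.
pose g n := linear_factor_surj (p_epi n) (ker_le n).
have gp n x : sval (g n) (p n x) = f n x := svalP (g n) x.
have g_comm n y : sval (g (n - 1)) (ch_d Y n y) = ch_d Z n (sval (g n) y).
  by have [x <-] := p_epi n y; rewrite -ch_comm !gp ch_comm.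
by exists (ChainMap g_comm).
Qed.

Lemma ch_factor_mono X Y Z (i : chain_map X Y) (f : chain_map Z Y) :
  ch_mono i -> (forall n z, exists x, i n x = f n z) ->
  exists g : chain_map Z X, is_comp i g f.
Proof.
move=> i_mono im_le.
pose g n := linear_factor_inj (@i_mono n) (im_le n).
have ig n z : i n (sval (g n) z) = f n z := svalP (g n) z.
have g_comm n z : sval (g (n - 1)) (ch_d Z n z) = ch_d X n (sval (g n) z).
  by apply: (i_mono (n - 1)); rewrite ig !ch_comm ig.
by exists (ChainMap g_comm).
Qed.

Definition subcomplex_prop X (P : forall n, X n -> Prop) :=
  (forall n, submodule_prop (@P n)) /\
  (forall n x, P n x -> P (n - 1) (ch_d X n x)).

Lemma subcomplex_exists X (P : forall n, X n -> Prop) :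
  subcomplex_prop P ->
  exists (S : chain_complex R) (i : chain_map S X),
    ch_mono i /\ forall n x, P n x <-> exists s, i n s = x.
Proof.
move=> [Psub Pd].
pose i n := submod_incl (Psub n).
have i_im n s : exists s', i (n - 1) s' = (ch_d X n \o i n : {linear _ -> _}) s.
  by apply/submod_inclP/Pd/(submod_inclP (Psub n)); exists s.
pose d n := linear_factor_inj (@submod_incl_inj _ _ _ (Psub (n - 1))) (@i_im n).
have i_comm n s : i (n - 1) (sval (d n) s) = ch_d X n (i n s) := svalP (d n) s.
have dd n s : sval (d (n - 1)) (sval (d n) s) = 0.
  by apply: submod_incl_inj; rewrite [LHS]i_comm i_comm ch_dd linear0.
exists (ChainComplex dd), (@ChainMap _ (ChainComplex dd) X i i_comm).
split=> n; first exact: submod_incl_inj.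
exact: submod_inclP.
Qed.

Lemma quotient_complex_exists X (P : forall n, X n -> Prop) :
  subcomplex_prop P ->
  exists (Q : chain_complex R) (p : chain_map X Q),
    ch_epi p /\ forall n x, p n x = 0 <-> P n x.
Proof.
move=> [Psub Pd].
pose p n := quotmod_proj (Psub n).
have p_ker n x : p n x = 0 ->
    (p (n - 1) \o ch_d X n : {linear _ -> _}) x = 0.
  by move=> /quotmod_proj_eq0 Px; apply/quotmod_proj_eq0/Pd.
pose d n := linear_factor_surj (@quotmod_proj_surj _ _ _ (Psub n)) (@p_ker n).
have p_comm n x : p (n - 1) (ch_d X n x) = sval (d n) (p n x).
  by rewrite (svalP (d n)).
have dd n y : sval (d (n - 1)) (sval (d n) y) = 0.
  have [x <-] := quotmod_proj_surj y.
  by rewrite -[quotmod_proj _ _]/(p n x) -!p_comm ch_dd linear0.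
exists (ChainComplex dd), (@ChainMap _ X (ChainComplex dd) p p_comm).
split=> n; first exact: quotmod_proj_surj.
exact: quotmod_proj_eq0.
Qed.

(** Projectivity lifts along epimorphisms only, so [p] and [f] are first corestricted to the image
    [S] of [p]. *)
Lemma projective_lift X Y (P : chain_complex R) (p : chain_map X Y)
    (f : chain_map P Y) :
  projective_complex P -> (forall n z, exists x, p n x = f n z) ->
  exists g : chain_map P X, is_comp p g f.
Proof.
move=> projP im_le.
have im_sub : subcomplex_prop (fun n y => exists x, p n x = y).
  split=> [n|n _ [x <-]]; last by exists (ch_d X n x); rewrite ch_comm.
  split=> [|a _ _ [x <-] [x' <-]]; first by exists 0; rewrite linear0.
  by exists (a *: x + x'); rewrite linearP.
have [S [i [i_mono iP]]] := subcomplex_exists im_sub.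
have [f' f'P] : exists f' : chain_map P S, is_comp i f' f.
  by apply: ch_factor_mono => // n z; apply/iP.
have [p' p'P] : exists p' : chain_map X S, is_comp i p' p.
  by apply: ch_factor_mono => // n x; apply/iP; exists x.
have [n s|g gP] := projP _ _ p' f'.
  have [x px] : exists x, p n x = i n s by apply/iP; exists s.
  by exists x; apply: (i_mono n); rewrite p'P.
by exists g => n z; rewrite -p'P gP f'P.
Qed.

End ChainMaps.

Arguments pr_proj {R X} p k.
Arguments pr_aug_epi {R X} p.

(** * Independence of Ext from the projective resolution *)

Section Resolutions.
Variable R : pzRingType.
Implicit Types X Y A K : chain_complex R.

Definition Ext_vanishes_on X (P : proj_resolution X) (k : nat) A : Prop :=
  forall f : chain_map (P k) A, ext_cocycle f -> ext_coboundary f.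

(** Only the part of a comparison [a : Q -> P], [b : P -> Q], [s : a b ~ 1] in
    degrees [n] and [n + 1] is recorded, so that it can be produced by a
    plain induction on [n], without dependent choice. *)
Definition homotopy_comparison X (P Q : proj_resolution X) (n : nat) : Prop :=
  exists (a0 : chain_map (Q n) (P n)) (a1 : chain_map (Q n.+1) (P n.+1))
         (b0 : chain_map (P n) (Q n)) (b1 : chain_map (P n.+1) (Q n.+1))
         (s0 : chain_map (P n) (P n.+1)) (s1 : chain_map (P n.+1) (P n.+2)),
  [/\ forall m x, pr_d P n m (a1 m x) = a0 m (pr_d Q n m x),
      forall m x, pr_d Q n m (b1 m x) = b0 m (pr_d P n m x)
    & forall m x, pr_d P n.+1 m (s1 m x) =
        a1 m (b1 m x) - x - s0 m (pr_d P n m x)].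

Lemma pr_dd X (P : proj_resolution X) k m x :
  pr_d P k m (pr_d P k.+1 m x) = 0.
Proof. by apply/(@pr_exactS _ _ P k m); exists x. Qed.

Lemma pr_aug_d X (P : proj_resolution X) m x :
  pr_aug P m (pr_d P 0 m x) = 0.
Proof. by apply/(@pr_exact0 _ _ P m); exists x. Qed.

Lemma resolution_lift X (P : proj_resolution X) Y k
    (f : chain_map Y (P k.+1)) :
  projective_complex Y -> (forall m y, pr_d P k m (f m y) = 0) ->
  exists g : chain_map Y (P k.+2), is_comp (pr_d P k.+1) g f.
Proof.
by move=> projY df0; apply: projective_lift => // m y; apply/pr_exactS.
Qed.

Lemma resolution_lift0 X (P : proj_resolution X) Y (f : chain_map Y (P 0)) :
  projective_complex Y -> (forall m y, pr_aug P m (f m y) = 0) ->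
  exists g : chain_map Y (P 1), is_comp (pr_d P 0) g f.
Proof.
by move=> projY df0; apply: projective_lift => // m y; apply/pr_exact0.
Qed.

Lemma homotopy_comparison_exists X (P Q : proj_resolution X) n :
  homotopy_comparison P Q n.
Proof.
elim: n => [|n [a0 [a1 [b0 [b1 [s0 [s1 [aP bP sP]]]]]]]].
  have [a0 a0P] : exists a0 : chain_map (Q 0) (P 0),
      is_comp (pr_aug P) a0 (pr_aug Q).
    exact: pr_proj (pr_aug_epi _).
  have [b0 b0P] : exists b0 : chain_map (P 0) (Q 0),
      is_comp (pr_aug Q) b0 (pr_aug P).
    exact: pr_proj (pr_aug_epi _).
  have [m y|a1 a1P] := resolution_lift0 (P := P) (f := ch_comp a0 (pr_d Q 0))
      (pr_proj Q 1).
    by rewrite /= a0P pr_aug_d.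
  have [m y|b1 b1P] := resolution_lift0 (P := Q) (f := ch_comp b0 (pr_d P 0))
      (pr_proj P 1).
    by rewrite /= b0P pr_aug_d.
  (* [a0] and [b0] both cover the identity of [X], so [a0 b0 - 1] vanishes in [X]: the homotopy
     starts from zero on [X]. *)
  have [m y|s0 s0P] := resolution_lift0 (P := P)
      (f := ch_sub (ch_comp a0 b0) (ch_id _)) (pr_proj P 0).
    by rewrite /= linearB /= a0P b0P subrr.
  have [m y|s1 s1P] := resolution_lift (P := P)
      (f := ch_sub (ch_sub (ch_comp a1 b1) (ch_id _)) (ch_comp s0 (pr_d P 0)))
      (pr_proj P 1).
    rewrite /= !linearB /= a1P /= b1P s0P /= /idfun.
    by rewrite subrr.
  by exists a0, a1, b0, b1, s0, s1.
have [m y|a2 a2P] := resolution_lift (P := P)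
    (f := ch_comp a1 (pr_d Q n.+1)) (pr_proj Q _).
  by rewrite /= aP pr_dd linear0.
have [m y|b2 b2P] := resolution_lift (P := Q)
    (f := ch_comp b1 (pr_d P n.+1)) (pr_proj P _).
  by rewrite /= bP pr_dd linear0.
(* With d the differential of [P], d(a2 b2 - 1 - s1 d) = a1 b1 d - d - (a1 b1 - 1 - s0 d) d = s0 d d
   = 0. *)
have [m y|s2 s2P] := resolution_lift (P := P)
    (f := ch_sub (ch_sub (ch_comp a2 b2) (ch_id _)) (ch_comp s1 (pr_d P n.+1)))
    (pr_proj P _).
  by rewrite /= !linearB /= a2P /= b2P sP /= pr_dd linear0 subr0 subrr.
by exists a1, a2, b1, b2, s1, s2.
Qed.

(** Pull [f] back to [f a1 = g d] on [Q]. Since [f] kills [d s1 = a1 b1 - 1 - s0 d], it follows that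
    [f = f a1 b1 - f s0 d = (g b0 - f s0) d]. *)
Lemma Ext_vanishes_on_indep X (P Q : proj_resolution X) k A :
  Ext_vanishes_on Q k.+1 A -> Ext_vanishes_on P k.+1 A.
Proof.
move=> extQ f fd0.
have [a0 [a1 [b0 [b1 [s0 [s1 [aP bP sP]]]]]]] := homotopy_comparison_exists P Q k.
have [m x|g gP] := extQ (ch_comp f a1).
  (* The comparison stops at [a1]; exactness of [P] replaces the next component in showing that
     [f a1] is a cocycle. *)
  have [y yP] : exists y, pr_d P k.+1 m y = a1 m (pr_d Q k.+1 m x).
    by apply/pr_exactS; rewrite aP pr_dd linear0.
  by rewrite /= -yP fd0.
exists (ch_sub (ch_comp g b0) (ch_comp f s0)) => m x /=.
rewrite -bP gP /=; apply/eqP; rewrite -subr_eq0 -!raddfB /=.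
by rewrite addrAC -sP fd0.
Qed.

End Resolutions.

(** * Ext against absolutely clean complexes, clean exact sequences, coresolving properties *)

Section AbsolutelyClean.
Variable R : pzRingType.
Implicit Types X Y A K F : chain_complex R.

Definition fg_resolution X (P : proj_resolution X) : Prop :=
  forall k, fg_complex (P k).

(** By independence of the resolution, finitely generated resolutions suffice, and these are what
    the finiteness arguments below need. *)
Lemma absolutely_cleanP A :
  absolutely_clean A <->
  forall X (P : proj_resolution X), fg_resolution P -> Ext_vanishes_on P 1 A.
Proof.
split=> [cleanA X P fgP|extA X [Q fgQ] P].
  by apply: cleanA; exists P.
exact: Ext_vanishes_on_indep (extA X Q fgQ).
Qed.

Definition syzygy_resolution X (P : proj_resolution X) K
    (e : chain_map (P 1) K) (e_epi : ch_epi e)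
    (e_exact : ch_exact (pr_d P 1) e) : proj_resolution K :=
  ProjResolution (pr_ob := fun k => P k.+1) (pr_d := fun k => pr_d P k.+1)
    (fun k => pr_proj P k.+1) e_epi e_exact (fun k => @pr_exactS _ _ P k.+1).

(** [K] is the kernel of the augmentation and [e] the corestriction of [pr_d P 0]: exactness at
    [P 0] makes [e] epi, and [i] being mono gives [e] the kernel of [pr_d P 0]. *)
Lemma syzygy_exists X (P : proj_resolution X) :
  exists K (i : chain_map K (P 0)) (e : chain_map (P 1) K),
    [/\ ch_mono i, is_comp i e (pr_d P 0), ch_epi e & ch_exact (pr_d P 1) e].
Proof.
have ker_sub : subcomplex_prop (fun n (x : P 0 n) => pr_aug P n x = 0).
  split=> [n|n x augx]; last by rewrite ch_comm augx linear0.
  split=> [|a x y augx augy]; first by rewrite linear0.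
  by rewrite linearP augx augy scaler0 addr0.
have [K [i [i_mono iP]]] := subcomplex_exists ker_sub.
have [n x|e eP] := @ch_factor_mono _ _ _ _ i (pr_d P 0) i_mono.
  exact/iP/pr_aug_d.
exists K, i, e; split=> // n y.
  have /pr_exact0[x xP] : pr_aug P n (i n y) = 0 by apply/iP; exists y.
  by exists x; apply: (i_mono n); rewrite eP.
rewrite -pr_exactS -eP; split=> [->|iey0]; first by rewrite linear0.
by apply: (i_mono n); rewrite iey0 linear0.
Qed.

(** Dimension shifting: cocycles and coboundaries of [P] in degree [k.+2] are, by conversion, those
    of the syzygy resolution in degree [k.+1]. *)
Lemma absolutely_clean_Ext A X (P : proj_resolution X) k :
  absolutely_clean A -> fg_resolution P -> Ext_vanishes_on P k.+1 A.
Proof.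
move=> cleanA; elim: k X P => [|k IHk] X P fgP.
  exact: (absolutely_cleanP A).1 cleanA X P fgP.
have [K [_ [e [_ _ e_epi e_exact]]]] := syzygy_exists P.
apply: (IHk K (syzygy_resolution e_epi e_exact)) => j; exact: fgP.
Qed.

Lemma cocycle0_factor X (P : proj_resolution X) Y (f : chain_map (P 0) Y) :
  comp0 f (pr_d P 0) -> exists g : chain_map X Y, is_comp g (pr_aug P) f.
Proof.
move=> fd0; apply: ch_factor_epi; first exact: pr_aug_epi.
by move=> n x /pr_exact0[y <-]; exact: fd0.
Qed.

Lemma exact_lift A' A A'' F (i : chain_map A' A) (p : chain_map A A'')
    (f : chain_map F A) :
  short_exact i p -> comp0 p f -> exists g : chain_map F A', is_comp i g f.
Proof.
move=> [i_mono ip_exact _] pf0; apply: ch_factor_mono => // n x.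
by apply/ip_exact; exact: pf0.
Qed.

Lemma short_exact_comp0 A' A A'' (i : chain_map A' A) (p : chain_map A A'') :
  short_exact i p -> comp0 p i.
Proof. by move=> [_ ip_exact _] n x; apply/ip_exact; exists x. Qed.

Lemma pure_clean_exact A' A A'' (i : chain_map A' A) (p : chain_map A A'') :
  pure_exact i p -> clean_exact i p.
Proof.
move=> [ex pureip]; split=> // F [P fgP]; apply: pureip.
exists (P 1), (P 0), (pr_d P 0), (pr_aug P); split.
- by split; [exact: pr_proj | exact: fgP].
- by split; [exact: pr_proj | exact: fgP].
- exact: pr_exact0.
- exact: pr_aug_epi.
Qed.

(** Extend [i f] to [g : P 0 -> A]. As [p g] kills boundaries, it descends to [h : X -> A''], which
    lifts to [h'] by cleanness. Subtracting [h'] composed with the augmentation pushes [g] into [A']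
    without changing it on boundaries. *)
Lemma clean_sub A' A A'' (i : chain_map A' A) (p : chain_map A A'') :
  clean_exact i p -> absolutely_clean A -> absolutely_clean A'.
Proof.
move=> [ex cleanip] /absolutely_cleanP cleanA; apply/absolutely_cleanP.
move=> X P fgP f fd0.
have [i_mono _ _] := ex.
have [n x|g gP] := cleanA X P fgP (ch_comp i f).
  by rewrite /= fd0 linear0.
have [n x|h hP] := @cocycle0_factor _ P _ (ch_comp p g).
  by rewrite /= gP /= (short_exact_comp0 ex).
have [_ _ /(_ h)[h' h'P]] := cleanip X (ex_intro _ P fgP).
have [n x|e eP] := @exact_lift _ _ _ _ i p
    (ch_sub g (ch_comp h' (pr_aug P))) ex.
  by rewrite /= linearB /= h'P hP subrr.
exists e => n x; apply: (i_mono n).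
by rewrite eP /= pr_aug_d linear0 subr0 gP.
Qed.

(** Factor [f] as [f' e] through the syzygy [K] and lift [f'] to [h : K -> A]. The cocycle [h e]
    extends to [g] on [P 0], and [p g] extends [f]. *)
Lemma clean_quotient A' A A'' (i : chain_map A' A) (p : chain_map A A'') :
  clean_exact i p -> absolutely_clean A -> absolutely_clean A''.
Proof.
move=> [ex cleanip] /absolutely_cleanP cleanA; apply/absolutely_cleanP.
move=> X P fgP f fd0.
have [K [j [e [_ je e_epi e_exact]]]] := syzygy_exists P.
have [f' f'P] : exists f' : chain_map K A'', is_comp f' e f.
  by apply: ch_factor_epi => // n x /e_exact[y <-]; exact: fd0.
have [|_ _ /(_ f')[h hP]] := cleanip K.
  by exists (syzygy_resolution e_epi e_exact) => k; exact: fgP.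
have [n x|g gP] := cleanA X P fgP (ch_comp h e).
  by rewrite /= (_ : e n _ = 0) ?linear0 //; apply/e_exact; exists x.
by exists (ch_comp p g) => n x; rewrite /= gP /= hP f'P.
Qed.

(** To lift [h : F -> A''], lift it first to [g : P 0 -> A]. On boundaries [g] gives a cocycle [f]
    into [A']; extending it to [f'] on [P 0], the difference [g - i f'] kills boundaries and
    descends to [F]. *)
Lemma absolutely_clean_kernel_clean_exact A' A A''
    (i : chain_map A' A) (p : chain_map A A'') :
  short_exact i p -> absolutely_clean A' -> clean_exact i p.
Proof.
move=> ex /absolutely_cleanP cleanA'; split=> // F [P fgP].
have [i_mono _ p_epi] := ex.
split=> [f g fg n x|h|h].
- by apply: (i_mono n); rewrite fg.
- split=> [|[f fP] n x]; first exact: exact_lift.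
  by rewrite -fP (short_exact_comp0 ex).
have [g gP] := pr_proj P 0 _ _ _ (ch_comp h (pr_aug P)) p_epi.
have [n x|f fP] := @exact_lift _ _ _ _ i p (ch_comp g (pr_d P 0)) ex.
  by rewrite /= gP /= pr_aug_d linear0.
have [n x|f' f'P] := cleanA' F P fgP f.
  by apply: (i_mono n); rewrite fP /= pr_dd !linear0.
have [n x|k kP] := @cocycle0_factor _ P _ (ch_sub g (ch_comp i f')).
  by rewrite /= f'P fP /= subrr.
exists k => n y; have [x <-] := pr_aug_epi P n y.
by rewrite kP linearB /= (short_exact_comp0 ex) subr0 gP.
Qed.

Lemma absolutely_clean_injective (J : chain_complex R) :
  injective_complex J -> absolutely_clean J.
Proof.
move=> injJ; apply/absolutely_cleanP => X P fgP f fd0.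
have [K [i [e [i_mono ie e_epi e_exact]]]] := syzygy_exists P.
have [f' f'P] : exists f' : chain_map K J, is_comp f' e f.
  by apply: ch_factor_epi => // n x /e_exact[y <-]; exact: fd0.
have [g gP] := injJ _ _ i f' i_mono.
by exists g => n x; rewrite -ie gP f'P.
Qed.

(** Write [p f = g d] and lift [g] to [g'] into [A]. Then [f - g' d] is a cocycle with values in
    [A'], hence of the form [i k d], and [f = (g' + i k) d]. *)
Lemma absolutely_clean_extension A' A A''
    (i : chain_map A' A) (p : chain_map A A'') :
  short_exact i p -> absolutely_clean A' -> absolutely_clean A'' ->
  absolutely_clean A.
Proof.
move=> ex /absolutely_cleanP cleanA' /absolutely_cleanP cleanA''.
apply/absolutely_cleanP => X P fgP f fd0.
have [i_mono _ p_epi] := ex.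
have [n x|g gP] := cleanA'' X P fgP (ch_comp p f).
  by rewrite /= fd0 linear0.
have [g' g'P] := pr_proj P 0 _ _ _ g p_epi.
have [n x|e eP] := @exact_lift _ _ _ _ i p
    (ch_sub f (ch_comp g' (pr_d P 0))) ex.
  by rewrite /= linearB /= g'P gP subrr.
have [n x|k kP] := cleanA' X P fgP e.
  by apply: (i_mono n); rewrite eP /= fd0 pr_dd !linear0 addr0.
exists (ch_add g' (ch_comp i k)) => n x.
by rewrite /= kP eP /= addrC subrK.
Qed.

Lemma absolutely_clean_product (I : Type) (X : I -> chain_complex R) A
    (pi : forall i, chain_map A (X i)) :
  is_product pi -> (forall i, absolutely_clean (X i)) -> absolutely_clean A.
Proof.
move=> prodA cleanX; apply/absolutely_cleanP => Z P fgP f fd0.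
have g_ex i : exists g : chain_map (P 0) (X i),
    is_comp g (pr_d P 0) (ch_comp (pi i) f).
  apply: ((absolutely_cleanP (X i)).1 (cleanX i) Z P fgP) => n x.
  by rewrite /= fd0 linear0.
pose g i := sval (cid (g_ex i)).
have gP i : is_comp (g i) (pr_d P 0) (ch_comp (pi i) f) := svalP (cid (g_ex i)).
have [[h hP] _] := prodA _ g.
have [_ uniq] := prodA _ (fun i => ch_comp (pi i) f).
exists h; apply: (uniq (ch_comp h (pr_d P 0)) f) => i n x //.
by rewrite /= hP gP.
Qed.

Lemma absolutely_clean_retract X Y :
  is_retract X Y -> absolutely_clean Y -> absolutely_clean X.
Proof.
move=> [s [r rs]] /absolutely_cleanP cleanY.
apply/absolutely_cleanP => Z P fgP f fd0.
have [n x|g gP] := cleanY Z P fgP (ch_comp s f).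
  by rewrite /= fd0 linear0.
by exists (ch_comp r g) => n x; rewrite /= gP /= rs.
Qed.

(** Compactness of finitely generated complexes: directedness absorbs first the finitely many
    generators of one degree, then the finitely many nonzero degrees. *)
Lemma fg_complex_directed_cover F (J : Type) (phi : J -> forall n, F n -> Prop) :
  fg_complex F ->
  (forall j n, submodule_prop (phi j n)) ->
  (forall j k, exists l, forall n x, phi j n x \/ phi k n x -> phi l n x) ->
  (forall n x, exists j, phi j n x) ->
  exists j, forall n x, phi j n x.
Proof.
move=> [[a [b F_bd]] F_fg] phi_sub phi_dir phi_cov.
have [j0 _] := phi_cov 0 0.
(* Finitely many conditions, each satisfiable and stable under enlarging [j], hold for a common
   [j]. *)
have common (m : nat) (Q : nat -> J -> Prop) :
    (forall i j l, (forall n x, phi j n x -> phi l n x) -> Q i j -> Q i l) ->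
    (forall i, exists j, Q i j) ->
    exists j, forall i, (i < m)%N -> Q i j.
  move=> Q_mono Q_ex; elim: m => [|m [j jP]]; first by exists j0.
  have [k kP] := Q_ex m; have [l lP] := phi_dir j k.
  exists l => i; rewrite ltnS leq_eqVlt => /orP[/eqP->|/jP].
    by apply: Q_mono kP => n x ?; apply: lP; right.
  by apply: Q_mono => n x ?; apply: lP; left.
have degree n : exists j, forall x, phi j n x.
  have [k [s s_gen]] := F_fg n.
  have [||j jP] :=
      common k (fun i j => forall o : 'I_k, o = i :> nat -> phi j n (s o)).
  - by move=> i j l jl ij o oi; apply/jl/ij.
  - move=> i; have [lt_ik|le_ki] := ltnP i k; last first.
      by exists j0 => o oi; move: (ltn_ord o); rewrite oi ltnNge le_ki.
    have [j jP] := phi_cov n (s (Ordinal lt_ik)); exists j => o oi.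
    by rewrite (_ : o = Ordinal lt_ik) //; apply: val_inj.
  exists j => x; have [c ->] := s_gen x; have [phi0 phiZD] := phi_sub j n.
  elim/big_ind: _ => // [y z py pz|o _].
    by rewrite -[y]scale1r; apply: phiZD.
  by rewrite -[_ *: _]addr0; apply: phiZD => //; apply: jP.
(* The degrees from [a] to [b], both included, are the [a + i] with [i <= b - a]; elsewhere every
   element is 0, which each [phi j] contains. *)
have [||j jP] := common (absz (b - a)).+1
    (fun i j => forall n, n = a + i%:Z -> forall x, phi j n x).
- by move=> i j l jl ij n ni x; apply/jl/ij.
- by move=> i; have [j jP] := degree (a + i%:Z); exists j => n ->.
exists j => n x; have [out|] := boolP ((n < a) || (b < n)).
  by rewrite (F_bd n out x); have [] := phi_sub j n.
rewrite negb_or -!leNgt => /andP[le_an le_nb].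
apply: (jP (absz (n - a))).
  by rewrite ltnS -lez_nat !gez0_abs ?subr_ge0 ?(le_trans le_an) // lerB.
by rewrite gez0_abs ?subr_ge0 // subrKC.
Qed.

End AbsolutelyClean.

(** * The product of a family of complexes *)

Section ProductComplex.
Variables (R : pzRingType) (J : Type) (X : J -> chain_complex R).

Let pd n (x : prodmod (fun j => X j n)) : prodmod (fun j => X j (n - 1)) :=
  fun j => ch_d (X j) n (x j).

Let pd_linear n : linear (@pd n).
Proof.
by move=> a x y; apply: functional_extensionality_dep => j; exact: linearP.
Qed.
HB.instance Definition _ n := GRing.isLinear.Build R _ _ *:%R (@pd n) (@pd_linear n).

Fact prod_complex_dd n x : pd (@pd n x) = 0.
Proof. by apply: functional_extensionality_dep => j; exact: ch_dd. Qed.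

Definition prod_complex : chain_complex R :=
  ChainComplex (ch_d := fun n => @pd n : {linear _ -> _}) prod_complex_dd.

Definition prod_complex_proj (j : J) n (x : prod_complex n) : X j n := x j.

Lemma prod_complex_proj_linear j n : linear (@prod_complex_proj j n).
Proof. by []. Qed.

Lemma prod_complex_proj_d j n (x : prod_complex n) :
  prod_complex_proj j (ch_d prod_complex n x) = ch_d (X j) n (prod_complex_proj j x).
Proof. by []. Qed.

Section Pairing.
Variables (Y : chain_complex R) (f : forall j, chain_map Y (X j)).

Let pairing n (y : Y n) : prod_complex n := fun j => f j n y.

Let pairing_linear n : linear (@pairing n).
Proof.
by move=> a x y; apply: functional_extensionality_dep => j; exact: linearP.
Qed.
HB.instance Definition _ n :=
  GRing.isLinear.Build R _ _ *:%R (@pairing n) (@pairing_linear n).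

Fact prod_complex_pairing_comm n (y : Y n) :
  pairing (ch_d Y n y) = ch_d prod_complex n (pairing y).
Proof. by apply: functional_extensionality_dep => j; exact: ch_comm. Qed.

Definition prod_complex_pairing : chain_map Y prod_complex :=
  ChainMap (ch_fun := fun n => @pairing n : {linear _ -> _})
    prod_complex_pairing_comm.

Lemma prod_complex_pairingE j n y :
  prod_complex_proj j (prod_complex_pairing n y) = f j n y.
Proof. by []. Qed.

End Pairing.
End ProductComplex.

(** * Directed colimits, over a whole preorder or an initial segment of an ordinal *)

Section DirectedColimit.
Variables (R : pzRingType) (disp : Order.disp_t) (I : preorderType disp).
Variables (D : diagram R I) (S : pred I) (C : chain_complex R).
Variable u : forall i : I, S i -> chain_map (D i) C.
Hypothesis colimC : is_colimit u.
Hypothesis S_inh : exists i, S i.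
Hypothesis S_dir : forall i j, S i -> S j -> exists k, [/\ S k, (i <= k)%O & (j <= k)%O].

Let uD i j (Si : S i) (Sj : S j) (ij : (i <= j)%O) n (x : D i n) :
  u Sj n (dg_map D ij n x) = u Si n x.
Proof. by case: colimC => + _; apply. Qed.

Let DD i j k (ij : (i <= j)%O) (jk : (j <= k)%O) (ik : (i <= k)%O) n (x : D i n) :
  dg_map D jk n (dg_map D ij n x) = dg_map D ik n x.
Proof. exact: dg_comp. Qed.

(** The images of the [D i] form, by directedness, a subcomplex. The projection onto its quotient
    agrees with 0 on every [D i], so it is 0 by uniqueness. *)
Lemma colimit_surj n (x : C n) : exists i (Si : S i) y, u Si n y = x.
Proof.
have im_sub : subcomplex_prop
    (fun n x => exists i (Si : S i) y, u Si n y = x).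
  split=> [m|m _ [i [Si [y <-]]]]; last first.
    by exists i, Si, (ch_d (D i) m y); rewrite ch_comm.
  split=> [|a _ _ [i [Si [y <-]]] [j [Sj [z <-]]]].
    by have [i Si] := S_inh; exists i, Si, 0; rewrite linear0.
  have [k [Sk ik jk]] := S_dir Si Sj.
  exists k, Sk, (a *: dg_map D ik m y + dg_map D jk m z).
  by rewrite linearP !(uD _ Sk).
have [Q [p [_ pP]]] := quotient_complex_exists im_sub.
have [_ /(_ Q (fun i _ => ch_zero (D i) Q))[|_ uniq]] := colimC.
  by move=> i j Si Sj ij m y.
apply/pP; apply: (uniq p (ch_zero C Q)) => i Si m y //.
by apply/pP; exists i, Si, y.
Qed.

(** The reduced product: the product of the [D j], [j] in [S], modulo the
    families that vanish for all large [j]; an element of [D i] dies in it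
    exactly when it dies in some [D k]. *)
Lemma colimit_eq0 i (Si : S i) n (y : D i n) :
  u Si n y = 0 -> exists k (ik : (i <= k)%O), S k /\ dg_map D ik n y = 0.
Proof.
pose J := {j | S j}.
pose T := prod_complex (fun j : J => D (sval j)).
have ev0_sub : subcomplex_prop (fun n (x : T n) =>
    exists k, S k /\ forall j : J, (k <= sval j)%O -> prod_complex_proj j x = 0).
  split=> [m|m x [k [Sk xk]]]; last first.
    exists k; split=> // j kj.
    by rewrite prod_complex_proj_d xk // linear0.
  split=> [|a x x' [k [Sk xk]] [k' [Sk' xk']]].
    by have [k Sk] := S_inh; exists k.
  have [l [Sl kl k'l]] := S_dir Sk Sk'; exists l; split=> // j lj.
  by rewrite prod_complex_proj_linear (xk _ (le_trans kl lj)) (xk' _ (le_trans k'l lj)) scaler0 addr0.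
have [Q [p [_ pP]]] := quotient_complex_exists ev0_sub.
(* The value 0 off the order relation is harmless: the quotient [Q] sees only large indices. *)
pose m j k : chain_map (D j) (D k) :=
  match pselect (j <= k)%O with
  | left jk => dg_map D jk
  | right _ => ch_zero (D j) (D k)
  end.
have mE j k (jk : (j <= k)%O) l x : m j k l x = dg_map D jk l x.
  by rewrite /m; case: pselect => // jk'; rewrite (bool_irrelevance jk' jk).
pose c j : chain_map (D j) T :=
  prod_complex_pairing (fun k : J => m j (sval k)).
have [_ /(_ Q (fun j _ => ch_comp p (c j)))[|[g gP] _]] := colimC.
  (* Cocone condition: the two families agree at every index above [k], hence in [Q]. *)
  move=> j k Sj Sk jk l x; apply/eqP; rewrite /= -subr_eq0 -linearB; apply/eqP/pP.
  exists k; split=> // h kh.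
  rewrite -[_ - _]addrC -scaleN1r prod_complex_proj_linear !prod_complex_pairingE.
  rewrite (mE _ _ (le_trans jk kh)) (mE _ _ kh).
  by rewrite (DD jk kh (le_trans jk kh)) scaleN1r addNr.
move=> uy0; have /pP[k [Sk ck0]] : p n (c i n y) = 0.
  by rewrite -[LHS]gP uy0 linear0.
have [l [Sl kl il]] := S_dir Sk Si; exists l, il; split=> //.
by rewrite -mE; apply: (ck0 (exist _ l Sl)).
Qed.

Lemma absolutely_clean_directed_colimit :
  (forall i, S i -> absolutely_clean (D i)) -> absolutely_clean C.
Proof.
move=> cleanD; apply/absolutely_cleanP => Z P fgP f fd0.
(* [P 1] is finitely generated, so the image of [f] lies in the image of a single [D i]. *)
have [i [Si fi]] : exists i (Si : S i),
    forall n x, exists y, u Si n y = f n x.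
  have [||n x|[i Si] iP] := @fg_complex_directed_cover _ _ {i | S i}
      (fun i n x => exists y, u (proj2_sig i) n y = f n x) (fgP 1).
  - move=> [i Si] n; split=> [|a x x' [y yx] [y' yx']].
      by exists 0; rewrite !linear0.
    by exists (a *: y + y'); rewrite !linearP yx yx'.
  - move=> [i Si] [j Sj]; have [k [Sk ik jk]] := S_dir Si Sj.
    exists (exist _ k Sk) => n x [] [y <-].
      by exists (dg_map D ik n y); apply: uD.
    by exists (dg_map D jk n y); apply: uD.
  - have [i [Si [y yx]]] := colimit_surj (f n x).
    by exists (exist _ i Si), y.
  by exists i, Si.
have [g gP] := projective_lift (pr_proj P 1) fi.
(* The lift [g] need not be a cocycle: its composite with [pr_d P 1] vanishes only in the colimit.
   As [P 2] is finitely generated, it already vanishes at some stage [k] above [i]. *)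
have [k [Sk [ik gk0]]] : exists k (Sk : S k) (ik : (i <= k)%O),
    forall n x, dg_map D ik n (g n (pr_d P 1 n x)) = 0.
  have [||n x|[k Pk] kP] := @fg_complex_directed_cover _ _
      {k | S k && (i <= k)%O}
      (fun k n x => forall ik : (i <= sval k)%O,
         dg_map D ik n (g n (pr_d P 1 n x)) = 0) (fgP 2).
  - move=> k n; split=> [ik|a x x' xk xk' ik]; first by rewrite !linear0.
    by rewrite !linearP xk xk' scaler0 addr0.
  - move=> [k Pk] [k' Pk']; have [/andP[Sk ik] /andP[Sk' ik']] := (Pk, Pk').
    have [l [Sl kl k'l]] := S_dir Sk Sk'.
    have Pl : S l && (i <= l)%O by rewrite Sl (le_trans ik).
    exists (exist _ l Pl) => n x [] /= xk il.
      by rewrite -(DD ik kl) xk linear0.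
    by rewrite -(DD ik' k'l) xk linear0.
  - have [|k [ik [Sk gk0]]] := @colimit_eq0 i Si n (g n (pr_d P 1 n x)).
      by rewrite gP fd0.
    have Pk : S k && (i <= k)%O by rewrite Sk.
    exists (exist _ k Pk) => ik'; rewrite -[RHS]gk0.
    by rewrite (bool_irrelevance ik' ik).
  by have /andP[Sk ik] := Pk; exists k, Sk, ik => n x; apply: kP.
have [h hP] := (absolutely_cleanP (D k)).1 (cleanD k Sk) Z P fgP
  (ch_comp (dg_map D ik) g) gk0.
by exists (ch_comp (u Sk) h) => n x; rewrite /= hP /= (uD Si) gP.
Qed.

End DirectedColimit.

(** * Direct sums, through finite supports *)

Section DirectSum.
Variables (R : pzRingType) (I : Type) (X : I -> chain_complex R).
Variables (C : chain_complex R) (inj : forall i, chain_map (X i) C).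
Hypothesis sumC : is_coproduct inj.

Lemma coproduct_proj_exists (i : I) : exists pr : chain_map C (X i),
  (forall n x, pr n (inj i n x) = x) /\
  (forall j, j <> i -> comp0 pr (inj j)).
Proof.
(* The Kronecker family: the identity, transported along [j = i], or zero. *)
pose m j : chain_map (X j) (X i) :=
  match pselect (j = i) with
  | left ji => eq_rect j (fun k => chain_map (X j) (X k)) (ch_id (X j)) i ji
  | right _ => ch_zero (X j) (X i)
  end.
have [[pr prP] _] := sumC m; exists pr; split=> [n x|j ji n x].
  by rewrite prP /m; case: pselect => // ii; rewrite (Prop_irrelevance ii erefl).
by rewrite prP /m; case: pselect.
Qed.

Lemma absolutely_clean_coproduct :
  (forall i, absolutely_clean (X i)) -> absolutely_clean C.
Proof.
move=> cleanX; apply/absolutely_cleanP => Z P fgP f fd0.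
pose pr i := sval (cid (coproduct_proj_exists i)).
have prK i n x : pr i n (inj i n x) = x.
  exact: (svalP (cid (coproduct_proj_exists i))).1.
have pr0 i j n x : j <> i -> pr i n (inj j n x) = 0.
  by move=> ji; apply: (svalP (cid (coproduct_proj_exists i))).2.
(* Asking for the decomposition over every duplicate-free [t] containing [s] makes [supp] monotone
   in [s], hence directed. [{classic I}] supplies decidable equality on [I]. *)
pose supp (s : seq {classic I}) n (x : C n) :=
  forall t : seq {classic I}, uniq t -> {subset s <= t} ->
    x = \sum_(i <- t) inj i n (pr i n x).
have supp_sub s n : submodule_prop (@supp s n).
  split=> [|a x y xs ys] t t_uniq st.
    by rewrite big1 // => i _; rewrite !linear0.
  rewrite {1}(xs t) // {1}(ys t) // scaler_sumr -big_split.
  by apply: eq_bigr => i _; rewrite !linearP.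
have supp_dir s s' : exists t, forall n x, @supp s n x \/ @supp s' n x -> @supp t n x.
  by exists (s ++ s') => n x [] xs t t_uniq st; apply: xs => // i si;
    apply: st; rewrite mem_cat si ?orbT.
have supp_cov n x : exists s, @supp s n x.
  (* The finitely supported elements form a subcomplex containing every summand, so the projection
     onto its quotient is 0 by uniqueness. *)
  have cov_sub : subcomplex_prop (fun n x => exists s, @supp s n x).
    split=> [m|m y [s ys]]; last first.
      exists s => t t_uniq st; rewrite {1}(ys t) // linear_sum.
      by apply: eq_bigr => i _; rewrite -!ch_comm.
    split=> [|a y z [s ys] [s' zs']].
      by exists [::]; have [] := supp_sub [::] m.
    have [t tP] := supp_dir s s'; exists t.
    by have [_ suppZD] := supp_sub t m; apply: suppZD; apply: tP; [left|right].
  have [Q [p [_ pP]]] := quotient_complex_exists cov_sub.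
  have [_ uniqC] := sumC (fun i => ch_zero (X i) Q).
  apply/pP; apply: (uniqC p (ch_zero C Q)) => i m y //.
  apply/pP; exists [:: i : {classic I}] => t t_uniq it.
  rewrite (bigD1_seq (i : {classic I})) ?it ?mem_head //= prK big1 ?addr0 //.
  by move=> j /eqP ji; rewrite pr0 ?linear0 // => ij; apply: ji.
have [||n x|s sP] := @fg_complex_directed_cover _ _ _
    (fun s n x => @supp s n (f n x)) (fgP 1).
- move=> s n; have [supp0 suppZD] := supp_sub s n.
  split=> [|a x y xs ys]; first by rewrite linear0.
  by rewrite linearP; apply: suppZD.
- by move=> s s'; have [t tP] := supp_dir s s'; exists t => n x; apply: tP.
- exact: supp_cov.
have g_ex i : exists g : chain_map (P 0) (X i),
    is_comp g (pr_d P 0) (ch_comp (pr i) f).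
  apply: ((absolutely_cleanP (X i)).1 (cleanX i) Z P fgP) => n x.
  by rewrite /= fd0 linear0.
(* Extend only the components in the support and add them up; [undup] because [supp] speaks of
   duplicate-free lists. *)
have [h hP] : exists h : chain_map (P 0) C, forall n x,
    h n (pr_d P 0 n x) = \sum_(i <- undup s) inj i n (pr i n (f n x)).
  elim: (undup s) => [|i t [h hP]].
    by exists (ch_zero _ _) => n x; rewrite big_nil.
  have [g gP] := g_ex i; exists (ch_add (ch_comp (inj i) g) h) => n x.
  by rewrite big_cons -hP /= gP.
exists h => n x; rewrite hP -(sP n x) ?undup_uniq // => i.
by rewrite mem_undup.
Qed.

End DirectSum.

(** * Transfinite extensions, and assembly of the closure properties *)

Lemma absolutely_clean_transfinite_extension (R : pzRingType)
    (X : chain_complex R) :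
  transfinite_extension (@absolutely_clean R) X -> absolutely_clean X.
Proof.
move=> [disp [I [D [wfI contD [i0 [bot0 clean0]] succD [u colimX]]]]].
(* A bottom stage is clean by assumption, a successor stage is an extension, and a limit stage is
   the directed colimit of the earlier ones. *)
have cleanD i : absolutely_clean (D i).
  elim/(well_founded_ind wfI): i => i IHi.
  have [boti|nboti] := EM (is_bottom i).
    by rewrite (_ : i = i0) //; apply/le_anti; rewrite boti bot0.
  have [[j ji]|nsucc] := EM (exists j, is_succ j i).
    have [lt_ji _] := ji.
    have [Q [q [ex cleanQ]]] := succD _ _ (ltW lt_ji) ji.
    exact: absolutely_clean_extension ex (IHi _ lt_ji) cleanQ.
  have limi : is_limit i by split=> // j ji; apply: nsucc; exists j.
  apply: (absolutely_clean_directed_colimit (contD i limi)).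
  (* A limit index is not the bottom, so [i0] lies strictly below it and the segment is
     inhabited. *)
  - by exists i0; rewrite lt_def bot0 andbT; apply/eqP => ii0; apply: nboti; rewrite ii0.
  - move=> j k ji ki; have [jk|/ltW kj] := leP j k; first by exists k.
    by exists j.
  - by move=> j ji; apply: IHi.
apply: (absolutely_clean_directed_colimit colimX) => // [|i j _ _].
  by exists i0.
by have [ij|/ltW ji] := leP i j; [exists j | exists i].
Qed.

Theorem proposition2p7 (R : pzRingType) :
  (forall A : chain_complex R, absolutely_clean A ->
     forall (n : nat) (X : chain_complex R),
       (0 < n)%N -> type_FPinf X -> Ext_vanishes n X A)
  /\ (closed_under_pure (@absolutely_clean R)
      /\ closed_under_clean (@absolutely_clean R))
  /\ coresolving (@absolutely_clean R)
  /\ (closed_under_products (@absolutely_clean R)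
      /\ closed_under_direct_sums (@absolutely_clean R)
      /\ closed_under_retracts (@absolutely_clean R)
      /\ closed_under_direct_limits (@absolutely_clean R)
      /\ closed_under_transfinite_extensions (@absolutely_clean R)).
Proof.
have clean_closed : closed_under_clean (@absolutely_clean R).
  move=> A' A A'' i p cl cleanA.
  by split; [exact: clean_sub cl cleanA | exact: clean_quotient cl cleanA].
split; [|split; [split=> //|split; [split|do 4?[split]]]].
(* [P] is an arbitrary resolution; the vanishing is transferred from the finitely generated [Q]. *)
- move=> A cleanA [//|k] X _ [Q fgQ] P.
  exact: Ext_vanishes_on_indep (absolutely_clean_Ext cleanA fgQ).
- by move=> A' A A'' i p /pure_clean_exact; apply: clean_closed.
- exact: absolutely_clean_injective.
- exact: absolutely_clean_extension.
(* A monomorphism with absolutely clean source is clean, so its cokernel is a clean quotient. *)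
- move=> A' A A'' i p ex cleanA'.
  exact: clean_quotient (absolutely_clean_kernel_clean_exact ex cleanA').
- exact: absolutely_clean_product.
- exact: absolutely_clean_coproduct.
- exact: absolutely_clean_retract.
- move=> disp I D X [[i0] dirI] [u colimX] cleanD.
  apply: (absolutely_clean_directed_colimit colimX) => // [|i j _ _].
    by exists i0.
  by have [k [ik jk]] := dirI i j; exists k.
- exact: absolutely_clean_transfinite_extension.
Qed.
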